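(* For the Legendre polynomials $P_n(x)$ and every natural number $n\ge 1$ we have \[P_{n}(x)= \left|\begin{array}{cccccc} x&-\frac 12&0&\cdots&0&0\\ -1&\frac 32 x&-\frac 23&\cdots&0&0\\ 0&-1&\frac53 x&\cdots&0&0\\ \vdots&\vdots&\vdots&\ddots&\vdots&\vdots\\ 0&0&0&\cdots&\frac{2n-3}{n-1} x&-\frac{n-1}{n}\\ 0&0&0&\cdots&-1&\frac{2n-1}{n} x\end{array}\right|,\] where the determinant has size $n$; that is, the matrix is the $n\times n$ tridiagonal matrix with $(i,i)$ entry $\frac{2i-1}{i}x$ for $1\le i\le n$, all subdiagonal entries equal to $-1$, and $(i,i+1)$ entry equal to $-\frac{i}{i+1}$ for $1\le i\le n-1$.
   Context: The Legendre polynomials are defined by $P_0(x)=1$, $P_1(x)=x$, and $P_{n+1}(x)=-\frac{n}{n+1}P_{n-1}(x)+\frac{2n+1}{n+1}xP_n(x)$ for $n\ge 1$. *)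

(* Defs.v *)
From mathcomp Require Import all_boot all_order all_algebra.

Set Implicit Arguments.
Unset Strict Implicit.
Unset Printing Implicit Defensive.

Import GRing.Theory Num.Theory.
Local Open Scope ring_scope.

(* In the last branch k = m.+1 >= 1, and the clause reads
   P_(k+1) = - k/(k+1) P_(k-1) + (2k+1)/(k+1) x P_k. *)
Fixpoint legendre (R : numFieldType) (n : nat) : {poly R} :=
  match n with
  | 0 => 1
  | k.+1 =>
    match k with
    | 0 => 'X
    | m.+1 => - (k%:R / k.+1%:R) *: legendre R m
              + ((2 * k + 1)%:R / k.+1%:R) *: ('X * legendre R k)
    end
  end.

(* Indices of 'I_n start at 0, so row i here is row i.+1 in the usual
   1-based numbering. *)
Definition legendre_mx (R : numFieldType) (n : nat) : 'M[{poly R}]_n :=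
  \matrix_(i < n, j < n)
    if j == i :> nat then ((2 * i.+1 - 1)%:R / i.+1%:R) *: 'X
    else if i == j.+1 :> nat then -1
    else if j == i.+1 :> nat then (- (i.+1%:R / i.+2%:R))%:P
    else 0.

(* Main.v *)
Require Import Defs.
From mathcomp Require Import all_boot all_order all_algebra.

(** The determinant of a tridiagonal matrix is a continuant: expanding along
    the last row expresses the leading minor of size [n + 2] through those of
    sizes [n + 1] and [n] ([det_tridiagonal_rec]).  For the matrix at hand the
    new diagonal entry is [(2n + 3) / (n + 2) * x], and the product of the two
    new off-diagonal entries is [(n + 1) / (n + 2)], so this recurrence is the
    three-term recurrence that defines the Legendre polynomials.  The two
    sequences also agree at sizes 0 and 1, hence they are equal. *)

Set Implicit Arguments.
Unset Strict Implicit.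
Unset Printing Implicit Defensive.

Import GRing.Theory.
Local Open Scope ring_scope.

(** Entries are indexed by all of [nat], so that one function [f] describes
    the whole nested family of leading submatrices. *)
Definition leading_mx (A : comNzRingType) (f : nat -> nat -> A) (n : nat) :
    'M[A]_n :=
  \matrix_(i < n, j < n) f i j.

(** In the last row only the entries in columns [n] and [n + 1] survive.  The
    minor of the latter is the leading minor of size [n + 1].  In the minor of
    the former the last column vanishes except at its bottom entry
    [f n n.+1], so expanding along that column leaves the leading minor of
    size [n]. *)
Lemma det_tridiagonal_rec (A : comNzRingType) (f : nat -> nat -> A)
    (f_low : forall i j, (j.+1 < i)%N -> f i j = 0)
    (f_up : forall i j, (i.+1 < j)%N -> f i j = 0) (n : nat) :
  \det (leading_mx f n.+2)
    = f n.+1 n.+1 * \det (leading_mx f n.+1)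
      - f n.+1 n * f n n.+1 * \det (leading_mx f n).
Proof.
rewrite (expand_det_row _ ord_max) !big_ord_recr /= big1 ?add0r; last first.
  by move=> i _; rewrite mxE /= f_low ?mul0r // !ltnS.
rewrite !mxE /= addrC; congr (_ * _ + _).
  rewrite /cofactor /= -signr_odd oddD addbb mul1r; congr (\det _).
  by apply/matrixP=> i j; rewrite !mxE !lift_max.
rewrite /cofactor /= -signr_odd oddD /= addNb addbb /= expr1 mulN1r mulrN.
rewrite -mulrA; congr (- (_ * _)).
rewrite (expand_det_col _ ord_max) big_ord_recr /= big1 ?add0r; last first.
  by move=> i _; rewrite !mxE lift_max /= /bump leqnn f_up ?mul0r // !ltnS.
rewrite !mxE lift_max /= /bump leqnn add1n; congr (_ * _).
rewrite /cofactor /= -signr_odd oddD addbb mul1r; congr (\det _).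
apply/matrixP=> i j; rewrite !mxE !lift_max /=; congr (f _ _).
(* Column [j < n] precedes the deleted column [n], so it is not shifted. *)
by rewrite {1}/bump [bump n j]lift_max leqNgt ltn_ord.
Qed.

Definition legendre_entry (R : numFieldType) (i j : nat) : {poly R} :=
  if j == i then ((2 * i.+1 - 1)%:R / i.+1%:R) *: 'X
  else if i == j.+1 then -1
  else if j == i.+1 then (- (i.+1%:R / i.+2%:R))%:P
  else 0.

Lemma legendre_mx_leading (R : numFieldType) (n : nat) :
  legendre_mx R n = leading_mx (@legendre_entry R) n.
Proof. by apply/matrixP=> i j; rewrite !mxE. Qed.

Lemma det_legendre_mx_rec (R : numFieldType) (n : nat) :
  \det (legendre_mx R n.+2)
    = - (n.+1%:R / n.+2%:R) *: \det (legendre_mx R n)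
      + ((2 * n.+1 + 1)%:R / n.+2%:R) *: ('X * \det (legendre_mx R n.+1)).
Proof.
rewrite !legendre_mx_leading det_tridiagonal_rec.
- move: (\det (leading_mx _ n.+1)) (\det (leading_mx _ n)) => D1 D0.
  rewrite /legendre_entry !eqxx ltn_eqF // gtn_eqF // ltn_eqF //.
  rewrite mulN1r -polyCN opprK mul_polyC scalerAl scaleNr addrC.
  by rewrite (mulnS 2 n.+1) addnC -addnBA.
- move=> i j ltji; rewrite /legendre_entry (ltn_eqF (ltnW ltji)).
  by rewrite (gtn_eqF ltji) (ltn_eqF (leqW (ltnW ltji))).
- move=> i j ltij; rewrite /legendre_entry (gtn_eqF (ltnW ltij)).
  by rewrite (ltn_eqF (leqW (ltnW ltij))) (gtn_eqF ltij).
Qed.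

Theorem proposition2p8 (R : numFieldType) (n : nat) (hn : (1 <= n)%N) :
  legendre R n = \det (legendre_mx R n).
Proof.
(* The recurrence has order two, so two consecutive sizes are carried along;
   starting them at size 0 makes the empty determinant match P_0 = 1. *)
suff [] : legendre R n = \det (legendre_mx R n)
       /\ legendre R n.+1 = \det (legendre_mx R n.+1) by [].
elim: n {hn} => [|n [IHn IHn1]].
  by rewrite det_mx00 det_mx11 mxE /= divr1 scale1r.
by split=> //; rewrite det_legendre_mx_rec -IHn -IHn1.
Qed.
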